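(* Let $d$ (input dimension), $c$ (output dimension) and $n$ (number of data points) be positive integers, let $p = 2n+d+c$, and let $X\in\mathbb{R}^{n\times d}$, $Y\in\mathbb{R}^{n\times c}$ and $\gamma\ge 0$. Then the following two optimization problems have the same optimal value. (Infinite-width training) $$\min_{\nu}\; \Big\| \int_{\mathbb{R}^d\times\mathbb{R}^c} (Xu)_+ v^\top \, d\nu(u,v) - Y \Big\|_F^2 + \frac{\gamma}{2}\int_{\mathbb{R}^d\times\mathbb{R}^c} \big(\|u\|_2^2+\|v\|_2^2\big)\, d\nu(u,v),$$ where the minimum is over all Borel probability measures $\nu$ on $\mathbb{R}^d\times\mathbb{R}^c$ such that $(x^\top u)_+ v$ is $\nu$-integrable for every $x\in\mathbb{R}^d$. (CP-NN) $$\min_{\Lambda \in \mathbb{R}^{p\times p}} \big\| P_\alpha \Lambda P_v^\top - Y \big\|_F^2 + \frac{\gamma}{2}\big(\mathrm{trace}(P_u\Lambda P_u^\top) + \mathrm{trace}(P_v \Lambda P_v^\top)\big)$$ subject to $$\mathrm{trace}(P_\alpha\Lambda P_\beta^\top) + \mathrm{trace}(M\Lambda M^\top) = 0,\qquad \Lambda \in \mathcal{PSD}_p,\qquad P_{\alpha\beta}\Lambda P_{\alpha\beta}^\top \in \mathcal{CP}_{2n}.$$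
   Context: $(\cdot)_+ = \max(0,\cdot)$ is applied entrywise (ReLU). The first problem is the training problem of the infinite-width two-layer ReLU network $\psi(x) = \int_{\mathbb{R}^d\times\mathbb{R}^c} (x^\top u)_+ v^\top d\nu(u,v)$, where $\nu$ is a probability measure on the Borel sets of $\mathbb{R}^{d+c}$. ''Optimal value'' means the infimum of the objective over the feasible set. $\mathcal{PSD}_k := \mathrm{conv}\{ww^\top : w\in\mathbb{R}^k\}$ is the cone of symmetric positive semidefinite $k\times k$ matrices, and $\mathcal{CP}_k := \mathrm{conv}\{ww^\top : w \in \mathbb{R}^k_+\}$ is the completely positive cone, where $\mathbb{R}^k_+$ denotes the entrywise non-negative vectors and $\mathrm{conv}$ the convex hull. The coordinates of $\mathbb{R}^p$, $p = 2n+d+c$, are split into consecutive blocks of sizes $n, n, d, c$, and the selection matrices are $P_\alpha = [\,I_{n}\;\; 0_{n\times n}\;\; 0_{n\times d}\;\; 0_{n\times c}\,]$, $P_\beta = [\,0_{n\times n}\;\; I_{n}\;\; 0_{n\times d}\;\; 0_{n\times c}\,]$, $P_u = [\,0_{d\times n}\;\; 0_{d\times n}\;\; I_{d}\;\; 0_{d\times c}\,]$, $P_v = [\,0_{c\times n}\;\; 0_{c\times n}\;\; 0_{c\times d}\;\; I_{c}\,]$, $P_{\alpha\beta} = \begin{bmatrix} P_\alpha \\ P_\beta\end{bmatrix} \in \mathbb{R}^{2n\times p}$, and $M = -P_\alpha + P_\beta + XP_u \in \mathbb{R}^{n\times p}$. *)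

(* Defs.v *)
From HB Require Import structures.
From mathcomp Require Import all_boot all_order all_algebra.
From mathcomp Require Import all_classical all_reals all_analysis.
Import Order.TTheory GRing.Theory Num.Theory.
Import numFieldNormedType.Exports.

Set Implicit Arguments.
Unset Strict Implicit.
Unset Printing Implicit Defensive.

Local Open Scope classical_set_scope.
Local Open Scope ring_scope.

Definition param_space (R : realType) (d c : nat) :=
  g_sigma_algebraType [set A : set ('cV[R]_d * 'cV[R]_c) | open A].

(* Also the Euclidean norm, on column vectors; the library's norm on matrices
   is the sup norm. *)
Definition frobenius (R : realType) (m k : nat) (A : 'M[R]_(m, k)) : R :=
  Num.sqrt (\sum_i \sum_j A i j ^+ 2).

Definition relu (R : realType) (m k : nat) (A : 'M[R]_(m, k)) : 'M[R]_(m, k) :=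
  map_mx (Num.max 0) A.

Section Integration.
Context (disp : measure_display) (T : measurableType disp) (R : realType).
Context (mu : {measure set T -> \bar R}) (m k : nat).
Implicit Type F : T -> 'M[R]_(m, k).

Definition mx_integrable F : Prop :=
  forall i j, mu.-integrable setT (fun t => (F t i j)%:E).

(* The entries are integrals of real functions, hence meaningful only when
   [mx_integrable F] holds. *)
Definition mx_integral F : 'M[R]_(m, k) :=
  \matrix_(i, j) (\int[mu]_t F t i j)%R.

End Integration.

Section Training.
Context (R : realType) (d c n : nat).
Context (X : 'M[R]_(n, d)) (Y : 'M[R]_(n, c)) (gamma : R).
Implicit Type nu : probability (param_space R d c) R.

Definition training_feasible nu : Prop :=
  forall x : 'cV[R]_d,
    mx_integrable nu (fun w : param_space R d c => relu (x^T *m w.1) *m w.2^T).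

(* Extended-real valued: the second moment of a feasible measure may be
   infinite.  For gamma = 0 the convention 0 * +oo = 0 applies. *)
Definition training_objective nu : \bar R :=
  ((frobenius
      (mx_integral nu (fun w : param_space R d c => relu (X *m w.1) *m w.2^T)
       - Y) ^+ 2)%:E
   + (gamma / 2)%:E
     * \int[nu]_w (frobenius w.1 ^+ 2 + frobenius w.2 ^+ 2)%:E)%E.

Definition training_value : \bar R :=
  ereal_inf [set training_objective nu | nu in training_feasible].

End Training.

Section Cones.
Context (R : realType).

Definition convex_hull (E : lmodType R) (S : set E) : set E :=
  [set y | exists (m : nat) (a : 'I_m -> R) (x : 'I_m -> E),
     [/\ forall i, 0 <= a i, \sum_i a i = 1, forall i, S (x i)
       & y = \sum_i a i *: x i]].

Definition PSD (k : nat) : set 'M[R]_k :=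
  convex_hull [set w *m w^T | w in [set: 'cV[R]_k]].

Definition CP (k : nat) : set 'M[R]_k :=
  convex_hull [set w *m w^T | w in [set w : 'cV[R]_k | forall i, 0 <= w i 0]].

End Cones.

Section CPNN.
Context (R : realType) (d c n : nat).

Definition P_alpha : 'M[R]_(n, (n + n) + (d + c)) :=
  row_mx (row_mx 1%:M 0) (row_mx 0 0).
Definition P_beta : 'M[R]_(n, (n + n) + (d + c)) :=
  row_mx (row_mx 0 1%:M) (row_mx 0 0).
Definition P_u : 'M[R]_(d, (n + n) + (d + c)) :=
  row_mx (row_mx 0 0) (row_mx 1%:M 0).
Definition P_v : 'M[R]_(c, (n + n) + (d + c)) :=
  row_mx (row_mx 0 0) (row_mx 0 1%:M).
Definition P_alphabeta : 'M[R]_(n + n, (n + n) + (d + c)) :=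
  col_mx P_alpha P_beta.

Context (X : 'M[R]_(n, d)) (Y : 'M[R]_(n, c)) (gamma : R).

Definition M_mx : 'M[R]_(n, (n + n) + (d + c)) := - P_alpha + P_beta + X *m P_u.

Implicit Type L : 'M[R]_((n + n) + (d + c)).

Definition cpnn_feasible L : Prop :=
  [/\ \tr (P_alpha *m L *m P_beta^T) + \tr (M_mx *m L *m M_mx^T) = 0,
      PSD L
    & CP (P_alphabeta *m L *m P_alphabeta^T)].

Definition cpnn_objective L : R :=
  frobenius (P_alpha *m L *m P_v^T - Y) ^+ 2
  + gamma / 2 * (\tr (P_u *m L *m P_u^T) + \tr (P_v *m L *m P_v^T)).

Definition cpnn_value : \bar R :=
  ereal_inf [set (cpnn_objective L)%:E | L in cpnn_feasible].

End CPNN.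

(* Main.v *)
From HB Require Import structures.
Require Import Defs.
From mathcomp Require Import all_boot all_order all_algebra.
From mathcomp Require Import all_classical all_reals all_analysis.
From mathcomp Require Import measurable_realfun ring lra.
Import Order.TTheory GRing.Theory Num.Theory.
Import numFieldNormedType.Exports.

Set Implicit Arguments.
Unset Strict Implicit.
Unset Printing Implicit Defensive.

Local Open Scope classical_set_scope.
Local Open Scope ring_scope.

(* A finite mixture of neurons (u, v) yields the feasible matrix that is the
   same mixture of z z^T, where z = ((Xu)_+, (-Xu)_+, u, v), with the same
   objective value. For an arbitrary measure, the vector of fit and penalty is
   the mean of an integrable random vector, hence lies in the closure of the
   convex hull of its range; since the loss is continuous in that vector,
   finite mixtures are enough. Only an infinite penalty has to be excluded, so
   infinite second moments do no harm when gamma = 0.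
   Conversely, a feasible Lambda = W W^T satisfies (S W)(S W)^T = B B^T for
   S = P_{alpha beta} and some B >= 0. A partial isometry carries S W to B, so
   Lambda = Z Z^T with S Z = [B 0] >= 0. The trace constraint then forces, in
   each column of Z, the alpha and beta blocks to be the positive and negative
   parts of X u, and the uniform measure on the columns rescaled by the square
   root of their number attains the objective of Lambda. *)

(** * Traces, ReLU identities and Gram factorizations *)

Lemma mxtrace_mulmx_tr (R : pzSemiRingType) m k (A B : 'M[R]_(m, k)) :
  \tr (A *m B^T) = \sum_i \sum_j A i j * B i j.
Proof.
by apply: eq_bigr => i _; rewrite mxE; apply: eq_bigr => j _; rewrite mxE.
Qed.

Lemma mulmx_tr_eq0 (R : realDomainType) m k (A : 'M[R]_(m, k)) :
  A *m A^T = 0 -> A = 0.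
Proof.
move=> A0; apply/matrixP => i j; rewrite mxE.
have : (A *m A^T) i i = 0 by rewrite A0 mxE.
rewrite mxE => /eqP; rewrite psumr_eq0; last first.
  by move=> l _; rewrite mxE -expr2 sqr_ge0.
by move=> /allP/(_ j); rewrite mem_index_enum mxE mulf_eq0 orbb => /(_ isT)/eqP.
Qed.

Lemma frobenius_sqr (R : realType) m k (A : 'M[R]_(m, k)) :
  frobenius A ^+ 2 = \sum_i \sum_j A i j ^+ 2.
Proof.
rewrite sqr_sqrtr // sumr_ge0 // => i _; rewrite sumr_ge0 // => j _.
exact: sqr_ge0.
Qed.

Lemma frobenius_sqr_trace (R : realType) m k (A : 'M[R]_(m, k)) :
  frobenius A ^+ 2 = \tr (A *m A^T).
Proof. by rewrite mxtrace_mulmx_tr frobenius_sqr. Qed.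

Lemma mul_max0_max0N (R : realDomainType) (a : R) :
  Num.max 0 a * Num.max 0 (- a) = 0.
Proof.
by case: (leP 0 a) => ?; rewrite ?mul0r // (max_idPl _) ?mulr0 ?oppr_le0.
Qed.

Lemma relu_subN (R : realType) m k (A : 'M[R]_(m, k)) : relu A - relu (- A) = A.
Proof.
apply/matrixP => i j; rewrite !mxE.
by case: (leP 0 (A i j)) => ?; case: (leP 0 (- A i j)) => ?; lra.
Qed.

(** One of [a], [b] vanishes, so they are the positive and negative parts of [a - b]. This later
    identifies the alpha block with the ReLU of [X u]. *)
Lemma max0_complementary (R : realDomainType) (a b x : R) :
  0 <= a -> 0 <= b -> a * b = 0 -> - a + b + x = 0 -> Num.max 0 x = a.
Proof.
move=> a0 b0 /eqP; rewrite mulf_eq0 => /orP[] /eqP ? ?.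
  by rewrite (max_idPl _); lra.
by rewrite (max_idPr _); lra.
Qed.

(* With G a generalized inverse of A A^T, where A = S W, the matrix
   A^T G A is the orthogonal projector onto the row space of A, and it equals
   Q Q^T for Q = A^T G B. *)
Lemma gram_factor_lift (R : realFieldType) p q m k
    (W : 'M[R]_(p, m)) (S : 'M[R]_(q, p)) (B : 'M[R]_(q, k)) :
  S *m (W *m W^T) *m S^T = B *m B^T ->
  exists Z : 'M[R]_(p, k + m), Z *m Z^T = W *m W^T /\ S *m Z = row_mx B 0.
Proof.
have [A defA] : exists A, A = S *m W by exists (S *m W).
rewrite mulmxA -mulmxA -trmx_mul -defA.
have [D defD] : exists D, D = A *m A^T by exists (A *m A^T).
rewrite -defD => AB.
have [G DGD] : exists G, D *m G *m D = D by exists (pinvmx D); rewrite mulmxKpV.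
(* The residual [(D H - 1) C] vanishes because its Gram matrix is [(D H - 1) D (D H - 1)^T]. *)
have reg H l (C : 'M[R]_(q, l)) :
    D *m H *m D = D -> C *m C^T = D -> D *m H *m C = C.
  move=> DHD CD; apply/eqP; rewrite -subr_eq0; apply/eqP; apply: mulmx_tr_eq0.
  rewrite -[X in _ - X]mul1mx -mulmxBl trmx_mul mulmxA -(mulmxA _ C) CD.
  by rewrite mulmxBl mul1mx DHD subrr mul0mx.
have DtD : D^T = D by rewrite defD trmx_mul trmxK.
(* [G] need not be symmetric, and [G^T] appears in [E E^T]. *)
have DGtD : D *m G^T *m D = D.
  by apply: trmx_inj; rewrite !trmx_mul trmxK DtD mulmxA.
pose Q := A^T *m G *m B; pose E := A^T *m G *m A.
have QE : Q *m Q^T = E *m E^T.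
  by rewrite /Q /E !trmx_mul trmxK !mulmxA -(mulmxA _ B) -AB defD !mulmxA.
have EEt : E *m E^T = E.
  rewrite /E !trmx_mul trmxK !mulmxA -(mulmxA _ A) -defD.
  by rewrite -!(mulmxA (A^T *m G)) reg.
have Et : E^T = E by rewrite -{1}EEt trmx_mul trmxK EEt.
have AQ : A *m Q = B by rewrite /Q !mulmxA -defD reg // -AB.
have AE : A *m E = A by rewrite /E !mulmxA -defD reg.
clearbody Q E.
(* [Q Q^T = E] covers the row space of [A] and [1 - E] its orthogonal complement, so
   [Z Z^T = W (E + (1 - E)) W^T]; the zero block is [A (1 - E)]. *)
exists (row_mx (W *m Q) (W *m (1%:M - E))); split.
  rewrite tr_row_mx mul_row_col !trmx_mul !mulmxA -(mulmxA W) QE EEt.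
  rewrite -(mulmxA W (_ - _)) linearB /= trmx1 mulmxBr mulmx1 mulmxBl mul1mx.
  by rewrite EEt Et subrr subr0 -mulmxDl -mulmxDr addrC subrK mulmx1.
by rewrite mul_mx_row !mulmxA -defA AQ mulmxBr mulmx1 AE subrr.
Qed.

(** The square root of each weight is absorbed into its vector, hence the scaling hypothesis.
    Weights with sum 1 exclude the empty combination, hence [m.+1] columns. *)
Lemma convex_hull_gram (R : realType) k (P : set 'cV[R]_k) (L : 'M[R]_k) :
  (forall (a : R) w, 0 <= a -> P w -> P (a *: w)) ->
  convex_hull [set w *m w^T | w in P] L ->
  exists m (W : 'M[R]_(k, m.+1)),
    (forall j, P (col j W)) /\ L = W *m W^T.
Proof.
move=> Psc [[|m] [a [x [a0 a1 xP ->]]]].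
  by move: a1; rewrite big_ord0 => /esym/eqP; rewrite oner_eq0.
have /choice[w wP] : forall i, exists w, P w /\ w *m w^T = x i.
  by move=> i; have [w Pw <-] := xP i; exists w.
exists m, (\matrix_(i, j) (Num.sqrt (a j) * w j i 0)); split=> [j|].
  have [Pw _] := wP j; have := Psc _ _ (sqrtr_ge0 (a j)) Pw.
  by congr P; apply/matrixP => i l; rewrite !mxE (ord1 l).
apply/matrixP => i j; rewrite summxE !mxE; apply: eq_bigr => l _.
have [_ <-] := wP l.
by rewrite !mxE big_ord1 !mxE mulrACA -expr2 sqr_sqrtr.
Qed.

(** * Closest points and means in the closed convex hull *)

Lemma convex_hull_segment (R : realType) (E : lmodType R) (S : set E)
    (x y : E) (s : R) :
  0 <= s <= 1 -> S x -> convex_hull S y ->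
  convex_hull S (y + s *: (x - y)).
Proof.
move=> /andP[s0 s1] Sx [m [a [z [a0 a1 Sz ->]]]].
exists m.+1, (fun i => if unlift ord0 i is Some j then (1 - s) * a j else s),
  (fun i => if unlift ord0 i is Some j then z j else x); split.
- by move=> i; case: unliftP => // j _; rewrite mulr_ge0 // subr_ge0.
- rewrite big_ord_recl unlift_none.
  under eq_bigr do rewrite liftK.
  by rewrite -mulr_sumr a1 mulr1 addrC subrK.
- by move=> i; case: unliftP.
rewrite big_ord_recl unlift_none.
under [in RHS]eq_bigr do rewrite liftK -scalerA.
rewrite -scaler_sumr scalerBr scalerBl scale1r addrCA; congr (_ + _).
Qed.

Lemma continuous_segment (R : numFieldType) (V : normedModType R)
    (s : R) (x : V) :
  continuous (fun y : V => y + s *: (x - y)).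
Proof.
move=> y; apply: cvgD; first exact: cvg_id.
by apply: cvgZ; [exact: cvg_cst|apply: cvgB; [exact: cvg_cst|exact: cvg_id]].
Qed.

Lemma continuous_sumr (R : realType) (T : topologicalType) (I : Type)
    (r : seq I) (f : I -> T -> R) :
  (forall i, continuous (f i)) -> continuous (fun t => \sum_(i <- r) f i t).
Proof.
by move=> fc; apply: continuous_big => //; exact: add_continuous.
Qed.

(** Squared Euclidean distance rather than the sup norm of ['rV[R]_N], because the closest-point
    argument needs an inner product. *)
Definition sqdist (R : realType) N (m y : 'rV[R]_N) : R :=
  \sum_i (y 0 i - m 0 i) ^+ 2.

Lemma continuous_sqdist (R : realType) N (m : 'rV[R]_N) :
  continuous (sqdist m).
Proof.
apply: continuous_sumr => i y.
have yi : z 0 i - m 0 i @[z --> y] --> y 0 i - m 0 i.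
  by apply: cvgB; [exact: coord_continuous|exact: cvg_cst].
exact: (cvgM yi yi).
Qed.

Lemma closest_point (R : realType) N (C : set 'rV[R]_N) (m : 'rV[R]_N) :
  closed C -> C !=set0 ->
  exists2 q, C q & forall y, C y -> sqdist m q <= sqdist m y.
Proof.
move=> Ccl [y0 Cy0].
(* Points outside this sublevel set are farther from [m] than [y0], so a minimizer on the compact
   set [K] is one on [C]. *)
pose K := C `&` [set y | sqdist m y <= sqdist m y0].
have Kcl : closed K.
  apply: closedI => //.
  apply: (@preimage_closed _ _ (sqdist m) [set z | z <= sqdist m y0]).
    by move=> y _; exact: continuous_sqdist.
  exact: closed_le.
have Kco : compact K.
  apply: bounded_closed_compact => //.
  (* The bound comes from [|y_j| <= |y_j - m_j| + |m_j|] and [t <= t^2 + 1]. *)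
  exists (sqdist m y0 + 1 + \sum_i `|m 0 i|); split; first exact: num_real.
  move=> M0 ltM y [_ /= ydist]; apply: le_trans (ltW ltM).
  rewrite [leLHS]mx_normrE.
  apply/bigmax_leP; split => [|[i j] _ /=].
    by rewrite !addr_ge0 ?sumr_ge0 // => ? _; rewrite sqr_ge0.
  rewrite (ord1 i) -[y 0 j](subrK (m 0 j)); apply: le_trans (ler_normD _ _) _.
  apply: lerD; last by rewrite (bigD1 j) //= lerDl sumr_ge0.
  apply: (@le_trans _ _ ((y 0 j - m 0 j) ^+ 2 + 1)).
    rewrite -[X in _ <= X + _]real_normK ?num_real //.
    have := sqr_ge0 (`|y 0 j - m 0 j| - 1).
    have := normr_ge0 (y 0 j - m 0 j).
    by move: (`|_|) => t ? ?; nra.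
  rewrite lerD2r; apply: le_trans ydist.
  by rewrite /sqdist (bigD1 j) //= lerDl sumr_ge0 // => ? _; rewrite sqr_ge0.
have [||q] := @EVT_min_rV R N (sqdist m) K _ Kco.
- by exists y0; split=> /=.
- by apply: continuous_subspaceT; exact: continuous_sqdist.
rewrite inE => -[Cq qy0] qmin; exists q => // y Cy.
have [yy0|/ltW y0y] := leP (sqdist m y) (sqdist m y0).
  by apply: qmin; rewrite inE; split.
exact: le_trans qy0 y0y.
Qed.

Lemma Rintegral_sum (disp : measure_display) (T : measurableType disp)
    (R : realType) (mu : {measure set T -> \bar R}) (I : Type) (r : seq I)
    (f : I -> T -> R) :
  (forall i, mu.-integrable setT (EFin \o f i)) ->
  \int[mu]_t (\sum_(i <- r) f i t) = \sum_(i <- r) (\int[mu]_t f i t)%R.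
Proof.
move=> fint; rewrite /Rintegral.
under eq_integral do rewrite -sumEFin.
rewrite integral_sum //.
rewrite (eq_bigr (fun i => (\int[mu]_t f i t)%R%:E)) ?sumEFin // => i _.
by rewrite /Rintegral fineK //;
  exact: (integrable_fin_num measurableT (fint i)).
Qed.

(* The closest point q to the mean m satisfies <q - m, F t - q> >= 0 for all t;
   integrating over t gives -|q - m|^2 >= 0. *)
Lemma mean_in_closure_convex_hull (disp : measure_display)
    (T : measurableType disp) (R : realType) (mu : probability T R) N
    (F : T -> 'rV[R]_N) :
  (forall i, mu.-integrable setT (fun t => (F t 0 i)%:E)) ->
  closure (convex_hull (range F)) (\row_i (\int[mu]_t F t 0 i)%R).
Proof.
move=> Fint; set m := \row__ _; set C := closure _.
have t0 : T := point.
have FC t : C (F t).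
  apply: subset_closure; exists 1%N, (fun=> 1), (fun=> F t).
  by split; rewrite // ?big_ord1 ?scale1r // => _; exists t.
have [||q Cq qmin] := @closest_point R N C m; first exact: closed_closure.
  by exists (F t0).
suff -> : m = q by [].
have qF t : 0 <= \sum_i (q 0 i - m 0 i) * (F t 0 i - q 0 i).
  set c := \sum_i _.
  pose e := \sum_i (F t 0 i - q 0 i) ^+ 2.
  (* The right-hand side is [|q + s (F t - q) - m|^2 - |q - m|^2]. *)
  have quad s : 0 <= s <= 1 -> 0 <= s *+ 2 * c + s ^+ 2 * e.
    move=> s01.
    have : C (q + s *: (F t - q)).
      (* [q] is only a limit of hull points; continuity carries the segment property over to the
         closure. *)
      have gc := @continuous_segment R 'rV[R]_N s (F t) q.
      move=> V /gc Vq; have [y [hy Vy]] := Cq _ Vq.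
      by exists (y + s *: (F t - y)); split=> //; apply: convex_hull_segment.
    move=> /qmin; rewrite -subr_ge0; congr (0 <= _).
    rewrite /sqdist -sumrB /c /e !mulr_sumr -big_split; apply: eq_bigr => i _.
    by rewrite !mxE /=; ring.
  rewrite leNgt; apply/negP => c0.
  have e0 : 0 <= e by rewrite sumr_ge0 // => i _; rewrite sqr_ge0.
  (* This [s] lies in [(0, 1]] and satisfies [s e <= - c], so [2 c + s e <= c < 0], against
     [quad]. *)
  pose s := - c / (e - c).
  have ec : 0 < e - c by rewrite subr_gt0 (lt_le_trans c0).
  have s0 : 0 < s by rewrite divr_gt0 ?oppr_gt0.
  have s1 : s <= 1 by rewrite ler_pdivrMr // mul1r lerDr.
  have := quad s; rewrite (ltW s0) s1 => /(_ isT).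
  rewrite expr2 mulrnAl -mulrnAr -mulrA -mulrDr pmulr_rge0 //.
  apply/negP; rewrite -ltNge.
  have se : s * e <= - c.
    rewrite /s mulrAC ler_pdivrMr // ler_wpM2l ?oppr_ge0 ?(ltW c0) //.
    by rewrite lerDl oppr_ge0 ltW.
  by lra.
have qm0 : sqdist m q <= 0.
  rewrite -oppr_ge0.
  have : 0 <= \int[mu]_t (\sum_i (q 0 i - m 0 i) * (F t 0 i - q 0 i)).
    by apply: Rintegral_ge0 => t _; exact: qF.
  have int_shift i : mu.-integrable setT
      (EFin \o (fun t => F t 0 i - q 0 i)).
    exact: (integrableB measurableT (Fint i)
      (finite_measure_integrable_cst mu (q 0 i) measurableT)).
  rewrite Rintegral_sum => [|i]; last first.
    exact: (integrableZl measurableT _ (int_shift i)).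
  congr (0 <= _); rewrite /sqdist -sumrN; apply: eq_bigr => i _.
  rewrite RintegralZl // RintegralB //; last 2 first.
  - exact: Fint.
  - exact: finite_measure_integrable_cst.
  rewrite Rintegral_cst //.
  have -> : fine (mu setT) = 1 by rewrite [mu _]probability_setT.
  by rewrite mulr1 expr2 -mulrN opprB [m 0 i]mxE.
apply/rowP => i; apply/eqP; rewrite eq_sym -subr_eq0 -sqrf_eq0.
have /eqP : sqdist m q = 0.
  by apply/le_anti; rewrite qm0 sumr_ge0 // => j _; rewrite sqr_ge0.
rewrite psumr_eq0 => [/allP/(_ i)|j _]; last by rewrite sqr_ge0.
by rewrite mem_index_enum => /(_ isT).
Qed.

(** * Uniform probability measures on finitely many points *)

Section UniformOnPoints.
Context (disp : measure_display) (T : measurableType disp) (R : realType).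
Context (N : nat) (t : 'I_N.+1 -> T).

(** [msum] takes a sequence indexed by [nat], hence [inord]; repeated points are counted with
    multiplicity. *)
Definition uniform_on_points : set T -> \bar R :=
  msum (fun k => mscale (N.+1%:R^-1)%:nng (\d_(t (inord k)))) N.+1.

HB.instance Definition _ := Measure.on uniform_on_points.

Lemma ge0_integral_uniform_on_points (f : T -> \bar R) :
  measurable_fun setT f -> (forall x, 0 <= f x)%E ->
  (\int[uniform_on_points]_x f x
   = \sum_(k < N.+1) (N.+1%:R^-1)%:E * f (t k))%E.
Proof.
move=> mf f0; rewrite ge0_integral_measure_sum //; apply: eq_bigr => k _.
by rewrite ge0_integral_mscale // integral_dirac // diracT mul1e inord_val.
Qed.

Let uniform_on_points_setT : uniform_on_points setT = 1%E.
Proof.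
rewrite /uniform_on_points /msum.
rewrite (eq_bigr (fun=> (N.+1%:R^-1)%:E)) => [|k _]; last first.
  transitivity ((N.+1%:R^-1)%:E * \d_(t (inord k)) [set: T] : \bar R)%E => //.
  by rewrite diracT mule1.
rewrite sumEFin sumr_const card_ord -[X in X%:E]mulr_natl divff //.
Qed.

HB.instance Definition _ :=
  Measure_isProbability.Build _ _ _ uniform_on_points uniform_on_points_setT.

Lemma integrable_uniform_on_points (f : T -> R) : measurable_fun setT f ->
  uniform_on_points.-integrable setT (EFin \o f).
Proof.
move=> mf; have mEf : measurable_fun setT (EFin \o f) by exact/measurable_EFinP.
apply/integrableP; split => //.
rewrite ge0_integral_uniform_on_points //; last exact: measurableT_comp.
under eq_bigr do rewrite -EFinM.
by rewrite sumEFin ltry.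
Qed.

Lemma integral_uniform_on_points (f : T -> R) : measurable_fun setT f ->
  (\int[uniform_on_points]_x (f x)%:E
   = (\sum_(k < N.+1) N.+1%:R^-1 * f (t k))%:E)%E.
Proof.
move=> mf; have mEf : measurable_fun setT (EFin \o f) by exact/measurable_EFinP.
rewrite integralE !ge0_integral_uniform_on_points //; last 2 first.
- exact: measurable_funeneg.
- exact: measurable_funepos.
under eq_bigr do rewrite funeposE -EFin_max -EFinM.
under [X in (_ - X)%E]eq_bigr do rewrite funenegE -EFinN -EFin_max -EFinM.
rewrite !sumEFin -EFinB -sumrB; congr EFin; apply: eq_bigr => k _.
rewrite -mulrBr; congr (_ * _).
by case: (leP (f (t k)) 0) => ?; case: (leP (- f (t k)) 0) => ?; lra.
Qed.

End UniformOnPoints.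

(** * Borel measurability of the integrands *)

Section Borel.
Context (R : realType) (d c : nat).

(** The sigma-algebra is generated by the open sets of the product, so it suffices that preimages of
    open intervals are open. *)
Lemma continuous_measurable_param_space (f : 'cV[R]_d * 'cV[R]_c -> R) :
  continuous f -> measurable_fun setT (f : param_space R d c -> R).
Proof.
move=> /continuousP cf; apply: (measurability _ (RGenOpens.measurableE R)).
move=> _ [_ [a [b ->] <-]]; rewrite setTI; apply: sub_sigma_algebra.
by apply: cf; exact: interval_open.
Qed.

Lemma measurable_coord_fst (i : 'I_d) :
  measurable_fun setT (fun w : param_space R d c => w.1 i 0).
Proof.
apply: continuous_measurable_param_space => w.
apply: (@continuous_comp _ _ _ fst (fun x : 'cV[R]_d => x i 0)).
  exact: cvg_fst.
exact: coord_continuous.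
Qed.

Lemma measurable_coord_snd (i : 'I_c) :
  measurable_fun setT (fun w : param_space R d c => w.2 i 0).
Proof.
apply: continuous_measurable_param_space => w.
apply: (@continuous_comp _ _ _ snd (fun x : 'cV[R]_c => x i 0)).
  exact: cvg_snd.
exact: coord_continuous.
Qed.

Lemma relu_outerE m (X : 'M[R]_(m, d)) (u : 'cV[R]_d) (v : 'cV[R]_c) i j :
  (relu (X *m u) *m v^T) i j = Num.max 0 (\sum_l X i l * u l 0) * v j 0.
Proof. by rewrite !mxE big_ord1 !mxE. Qed.

Lemma measurable_relu_outer m (X : 'M[R]_(m, d)) i j :
  measurable_fun setT
    (fun w : param_space R d c => (relu (X *m w.1) *m w.2^T) i j).
Proof.
rewrite (_ : (fun w => _) = (fun w : param_space R d c =>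
    Num.max 0 (\sum_l X i l * w.1 l 0) * w.2 j 0)); last first.
  by apply/funext => w; exact: relu_outerE.
apply: measurable_funM; last exact: measurable_coord_snd.
apply: measurable_maxr => //; apply: measurable_sum => l.
by apply: measurable_funM => //; exact: measurable_coord_fst.
Qed.

Lemma measurable_sqnorm_param :
  measurable_fun setT
    (fun w : param_space R d c => frobenius w.1 ^+ 2 + frobenius w.2 ^+ 2).
Proof.
rewrite (_ : (fun w => _) = (fun w : param_space R d c =>
    \sum_i \sum_j w.1 i j ^+ 2 + \sum_i \sum_j w.2 i j ^+ 2)); last first.
  by apply/funext => w; rewrite !frobenius_sqr.
apply: measurable_funD; apply: measurable_sum => i; apply: measurable_sum => j;
  apply: measurable_funX; rewrite (ord1 j).
- exact: measurable_coord_fst.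
- exact: measurable_coord_snd.
Qed.

End Borel.

(** * Block selection and mixtures of outer products *)

Section Blocks.
Context (R : realType) (d c n q : nat).
Context (a b : 'M[R]_(n, q)) (u : 'M[R]_(d, q)) (v : 'M[R]_(c, q)).

Lemma P_alpha_col_mx :
  P_alpha R d c n *m col_mx (col_mx a b) (col_mx u v) = a.
Proof. by rewrite !mul_row_col !mul0mx mul1mx !addr0. Qed.

Lemma P_beta_col_mx :
  P_beta R d c n *m col_mx (col_mx a b) (col_mx u v) = b.
Proof. by rewrite !mul_row_col !mul0mx mul1mx !addr0 add0r. Qed.

Lemma P_u_col_mx : P_u R d c n *m col_mx (col_mx a b) (col_mx u v) = u.
Proof. by rewrite !mul_row_col !mul0mx mul1mx !addr0 add0r. Qed.

Lemma P_v_col_mx : P_v R d c n *m col_mx (col_mx a b) (col_mx u v) = v.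
Proof. by rewrite !mul_row_col !mul0mx mul1mx !add0r. Qed.

End Blocks.

Lemma sandwich_sum_outer (R : comPzRingType) p m1 m2 N (A : 'M[R]_(m1, p))
    (B : 'M[R]_(m2, p)) (a : 'I_N -> R) (z : 'I_N -> 'cV[R]_p) :
  A *m (\sum_l a l *: (z l *m (z l)^T)) *m B^T
  = \sum_l a l *: ((A *m z l) *m (B *m z l)^T).
Proof.
rewrite mulmx_sumr mulmx_suml; apply: eq_bigr => l _.
by rewrite -scalemxAr -scalemxAl trmx_mul !mulmxA.
Qed.

(** * From measures to matrices *)

Section TrainingToCP.
Context (R : realType) (d c n : nat).
Context (X : 'M[R]_(n, d)) (Y : 'M[R]_(n, c)) (gamma : R).

Let neuron (w : 'cV[R]_d * 'cV[R]_c) : 'cV[R]_((n + n) + (d + c)) :=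
  col_mx (col_mx (relu (X *m w.1)) (relu (- (X *m w.1)))) (col_mx w.1 w.2).

(** Each neuron vector [z] has [M z = 0], and its nonnegative alpha and beta blocks have entrywise
    product zero, so both traces vanish term by term. *)
Lemma mixture_cpnn_feasible N (a : 'I_N -> R) w :
  (forall l, 0 <= a l) -> \sum_l a l = 1 ->
  cpnn_feasible X (\sum_l a l *: (neuron (w l) *m (neuron (w l))^T)).
Proof.
move=> a0 a1; split.
- rewrite !sandwich_sum_outer.
  rewrite linear_sum /= linear_sum /= !big1 ?addr0 // => l _.
    have -> : M_mx c X *m neuron (w l) = 0.
      rewrite mulmxDl mulmxDl mulNmx -mulmxA.
      rewrite P_alpha_col_mx P_beta_col_mx P_u_col_mx.
      by rewrite [- _ + _]addrC -opprB relu_subN addNr.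
    by rewrite mul0mx scaler0 linear0.
  rewrite P_alpha_col_mx P_beta_col_mx linearZ /= mxtrace_mulmx_tr.
  by rewrite big1 ?mulr0 // => i _; rewrite big_ord1 !mxE mul_max0_max0N.
- by exists N, a, (fun l => neuron (w l) *m (neuron (w l))^T); split.
rewrite sandwich_sum_outer.
exists N, a, (fun l => P_alphabeta R d c n *m neuron (w l) *m
  (P_alphabeta R d c n *m neuron (w l))^T); split=> // l.
exists (P_alphabeta R d c n *m neuron (w l)) => // i.
rewrite mul_col_mx P_alpha_col_mx P_beta_col_mx.
by case: (split_ordP i) => j ->; rewrite ?col_mxEu ?col_mxEd mxE le_max lexx.
Qed.

(** The objective is [loss] at the mean of this vector. The factor [gamma / 2] is kept inside, so
    for [gamma = 0] the last coordinate is integrable even when the second moment is infinite. *)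
Let stats (w : 'cV[R]_d * 'cV[R]_c) : 'rV[R]_(n * c + 1) :=
  row_mx (mxvec (relu (X *m w.1) *m w.2^T))
    (gamma / 2 * (frobenius w.1 ^+ 2 + frobenius w.2 ^+ 2))%:M.

Let loss (y : 'rV[R]_(n * c + 1)) : R :=
  \sum_i \sum_j (y 0 (lshift 1 (mxvec_index i j)) - Y i j) ^+ 2
  + y 0 (rshift (n * c) 0).

Let loss_continuous : continuous loss.
Proof.
suff sc : continuous (fun y : 'rV[R]_(n * c + 1) =>
    \sum_i \sum_j (y 0 (lshift 1 (mxvec_index i j)) - Y i j) ^+ 2).
  by move=> y; apply: (cvgD (sc y)); exact: coord_continuous.
apply: continuous_sumr => i; apply: continuous_sumr => j y.
have yij : z 0 (lshift 1 (mxvec_index i j)) - Y i j @[z --> y]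
    --> y 0 (lshift 1 (mxvec_index i j)) - Y i j.
  by apply: cvgB; [exact: coord_continuous|exact: cvg_cst].
exact: (cvgM yij yij).
Qed.

Let stats_fit w i j :
  stats w 0 (lshift 1 (mxvec_index i j)) = (relu (X *m w.1) *m w.2^T) i j.
Proof. by rewrite row_mxEl mxvecE. Qed.

Let stats_penalty w : stats w 0 (rshift (n * c) 0) =
  gamma / 2 * (frobenius w.1 ^+ 2 + frobenius w.2 ^+ 2).
Proof. by rewrite row_mxEr mxE eqxx mulr1n. Qed.

Let cpnn_value_le_loss y :
  convex_hull (range stats) y -> (cpnn_value X Y gamma <= (loss y)%:E)%E.
Proof.
move=> [N [a [x [a0 a1 xr ->]]]].
have /choice[w wx] : forall l, exists w, stats w = x l.
  by move=> l; have [w _ <-] := xr l; exists w.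
apply: ereal_inf_lbound.
exists (\sum_l a l *: (neuron (w l) *m (neuron (w l))^T)).
  exact: mixture_cpnn_feasible.
congr EFin; rewrite /cpnn_objective frobenius_sqr !sandwich_sum_outer.
congr (_ + _).
  apply: eq_bigr => i _; apply: eq_bigr => j _; rewrite mxE [in RHS]summxE.
  rewrite [in LHS]mxE summxE; congr ((_ + _) ^+ 2).
  apply: eq_bigr => l _; rewrite P_alpha_col_mx P_v_col_mx.
  by rewrite [in LHS]mxE [in RHS]mxE -wx stats_fit.
rewrite summxE !linear_sum -big_split mulr_sumr; apply: eq_bigr => l _ /=.
rewrite [in RHS]mxE -wx stats_penalty P_u_col_mx P_v_col_mx !linearZ /=.
by rewrite -!frobenius_sqr_trace -mulrDr mulrCA.
Qed.

Lemma cpnn_value_le_training_objective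
    (nu : probability (param_space R d c) R) :
  0 <= gamma -> training_feasible nu ->
  (cpnn_value X Y gamma <= training_objective X Y gamma nu)%E.
Proof.
move=> gamma0 nuP; rewrite /training_objective.
have g20 : 0 <= gamma / 2 by rewrite divr_ge0.
set h := fun w : param_space R d c => frobenius w.1 ^+ 2 + frobenius w.2 ^+ 2.
have h0 w : 0 <= h w by rewrite addr_ge0 ?sqr_ge0.
have mh : measurable_fun setT h by exact: measurable_sqnorm_param.
(* With [gamma / 2] under the integral, the convention [0 * +oo = 0] becomes the integral of the
   zero function. *)
rewrite -ge0_integralZl_EFin //; last 2 first.
- by move=> w _; rewrite lee_fin; exact: h0.
- exact/measurable_EFinP.
set I := (\int[nu]_w _)%E.
have I0 : (0 <= I)%E.
  apply: integral_ge0 => w _; rewrite -EFinM lee_fin.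
  exact: mulr_ge0 g20 (h0 w).
have mgh : measurable_fun setT (fun w => gamma / 2 * h w).
  exact: measurable_funM.
have [Ioo|Ifin] := eqVneq I +oo%E; first by rewrite Ioo addey ?leey.
have Iint : nu.-integrable setT (fun w => (gamma / 2 * h w)%:E).
  apply/integrableP; split; first exact/measurable_EFinP.
  rewrite ltey (eq_integral (fun w => (gamma / 2)%:E * (h w)%:E)%E) //.
  by move=> w _; rewrite gee0_abs ?lee_fin ?mulr_ge0.
have stats_int i :
    nu.-integrable setT (fun w : param_space R d c => (stats w 0 i)%:E).
  case: (split_ordP i) => j ->.
    case/mxvec_indexP: j => k j.
    (* Feasibility is used at the data points, the rows of [X]. *)
    have := nuP (row k X)^T 0 j.
    rewrite trmxK; congr (nu.-integrable _ _); apply/funext => w.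
    by rewrite stats_fit !relu_outerE; under eq_bigr do rewrite mxE.
  rewrite (ord1 j); move: Iint; congr (nu.-integrable _ _).
  by apply/funext => w; rewrite stats_penalty.
have := mean_in_closure_convex_hull stats_int; set m := \row__ _ => m_cl.
have -> : ((frobenius (mx_integral nu (fun w : param_space R d c =>
    relu (X *m w.1) *m w.2^T) - Y) ^+ 2)%:E + I = (loss m)%:E)%E.
  rewrite /loss EFinD frobenius_sqr; congr (_ + _)%E.
    congr EFin; apply: eq_bigr => i _; apply: eq_bigr => j _.
    rewrite !mxE; congr ((_ - _) ^+ 2).
    by apply: eq_Rintegral => w _; rewrite stats_fit.
  rewrite mxE /Rintegral fineK; last exact: integrable_fin_num.
  by apply: eq_integral => w _; rewrite stats_penalty EFinM.
have := cpnn_value_le_loss; case: (cpnn_value _ _ _) => [r||] // le_loss.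
  (* The closed set where [loss] is at least [r] contains the hull, hence its closure and the mean
     [m]. *)
  have cl : closed [set y | r <= loss y].
    apply: (@preimage_closed _ _ loss [set z | r <= z]).
      by move=> y _; exact: loss_continuous.
    exact: closed_ge.
  rewrite lee_fin; apply: cl; apply: closure_subset m_cl => y /le_loss.
  by rewrite lee_fin.
  (* The value [+oo] is impossible: the hull is nonempty and [loss] is finite on it. *)
  have [y [hy _]] := m_cl setT filterT.
  by have := le_loss y hy.
by rewrite leNye.
Qed.

End TrainingToCP.

(** * From matrices to measures *)

Section CPToTraining.
Context (R : realType) (d c n : nat).
Context (X : 'M[R]_(n, d)) (Y : 'M[R]_(n, c)) (gamma : R).

Lemma cpnn_feasible_factor L : cpnn_feasible X L ->
  exists N (u : 'M[R]_(d, N.+1)) (v : 'M[R]_(c, N.+1)),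
  [/\ P_alpha R d c n *m L *m (P_v R d c n)^T = relu (X *m u) *m v^T,
      P_u R d c n *m L *m (P_u R d c n)^T = u *m u^T
    & P_v R d c n *m L *m (P_v R d c n)^T = v *m v^T].
Proof.
move=> [trL psdL cpL].
have [//|m [W [_ LW]]] := convex_hull_gram _ psdL.
have [|k [B [B0 abB]]] := convex_hull_gram _ cpL.
  by move=> a w a0 w0 i; rewrite mxE mulr_ge0.
rewrite LW in abB; have [Z [ZW abZ]] := gram_factor_lift abB.
(* [Z] has [k.+1 + m.+1] columns, which is the successor of this number. *)
rewrite -{}LW in ZW; exists (k + m.+1)%N.
pose a := P_alpha R d c n *m Z; pose b := P_beta R d c n *m Z.
pose u := P_u R d c n *m Z; pose v := P_v R d c n *m Z.
have gramE m1 m2 (A : 'M[R]_(m1, _)) (C : 'M[R]_(m2, _)) :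
    A *m L *m C^T = (A *m Z) *m (C *m Z)^T.
  by rewrite -ZW trmx_mul !mulmxA.
have ab0 i j : 0 <= (P_alphabeta R d c n *m Z) i j.
  rewrite abZ; case: (split_ordP j) => l ->;
    rewrite ?row_mxEl ?row_mxEr ?mxE //.
  by have := B0 l i; rewrite mxE.
have a0 i j : 0 <= a i j.
  by have := ab0 (lshift n i) j; rewrite mul_col_mx col_mxEu.
have b0 i j : 0 <= b i j.
  by have := ab0 (rshift n i) j; rewrite mul_col_mx col_mxEd.
have MZ : M_mx c X *m Z = - a + b + X *m u.
  by rewrite mulmxDl mulmxDl mulNmx mulmxA.
(* Both traces are sums of nonnegative terms, [a b] and squares, so their zero sum forces each to
   vanish, and then each term. *)
have abM0 : (\sum_i \sum_j a i j * b i j == 0) &&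
    (\sum_i \sum_j (M_mx c X *m Z) i j * (M_mx c X *m Z) i j == 0).
  rewrite -paddr_eq0.
  - by rewrite -!mxtrace_mulmx_tr -!gramE trL.
  - by apply: sumr_ge0 => i _; apply: sumr_ge0 => j _; exact: mulr_ge0.
  - apply: sumr_ge0 => i _; apply: sumr_ge0 => j _.
    by rewrite -expr2 sqr_ge0.
have sum0 (f : 'I_n -> 'I_(k.+1 + m.+1) -> R) :
    (forall i j, 0 <= f i j) -> \sum_i \sum_j f i j == 0 ->
    forall i j, f i j = 0.
  move=> f0; rewrite psumr_eq0 => [/allP s0 i j|i _]; last by rewrite sumr_ge0.
  have := s0 i (mem_index_enum _); rewrite psumr_eq0 // => /allP/(_ j).
  by move=> /(_ (mem_index_enum _))/eqP.
have /andP[/sum0 ab /sum0 MM] := abM0.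
have aE : a = relu (X *m u).
  apply/matrixP => i j; rewrite [RHS]mxE; apply: esym.
  apply: (@max0_complementary _ _ (b i j)) => //.
    by apply: ab => ? ?; rewrite mulr_ge0.
  have /eqP : (M_mx c X *m Z) i j * (M_mx c X *m Z) i j = 0.
    by apply: MM => ? ?; rewrite -expr2 sqr_ge0.
  by rewrite mulf_eq0 orbb MZ !mxE => /eqP.
by exists u, v; rewrite -aE !gramE.
Qed.

Lemma cpnn_feasible_training L : cpnn_feasible X L ->
  exists2 nu : probability (param_space R d c) R, training_feasible nu
    & training_objective X Y gamma nu = (cpnn_objective Y gamma L)%:E.
Proof.
move=> /cpnn_feasible_factor[N [u [v [avE uuE vvE]]]].
(* ReLU is positively homogeneous, so fit and penalty scale by [s^2], which cancels the weight
   [1 / N.+1] of each point. *)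
pose s : R := Num.sqrt N.+1%:R.
have ss : N.+1%:R^-1 * (s * s) = 1.
  by rewrite -expr2 sqr_sqrtr ?ler0n // mulVf ?pnatr_eq0.
pose t (k : 'I_N.+1) : param_space R d c := (s *: col k u, s *: col k v).
have s0 : 0 <= s by exact: sqrtr_ge0.
exists (uniform_on_points R t).
  move=> x i j; apply: integrable_uniform_on_points.
  exact: measurable_relu_outer.
rewrite /training_objective /cpnn_objective.
rewrite integral_uniform_on_points; last exact: measurable_sqnorm_param.
rewrite -EFinM -EFinD; congr (_%:E); congr (_ + _ * _).
  congr (frobenius (_ - _) ^+ 2); rewrite avE; apply/matrixP => i j.
  rewrite mxE /Rintegral integral_uniform_on_points; last first.
    exact: measurable_relu_outer.
  rewrite /= [RHS]mxE; apply: eq_bigr => k _.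
  rewrite relu_outerE /= !mxE.
  rewrite (eq_bigr (fun l => s * (X i l * u l k))) => [|l _]; last first.
    by rewrite !mxE mulrCA.
  rewrite -mulr_sumr; set S := \sum_l _.
  have -> : Num.max 0 (s * S) = s * Num.max 0 S by rewrite maxr_pMr // mulr0.
  by rewrite mulrACA [LHS]mulrA ss mul1r.
rewrite uuE vvE !mxtrace_mulmx_tr.
rewrite exchange_big [X in _ = _ + X]exchange_big -big_split /=.
apply: eq_bigr => k _; rewrite !frobenius_sqr mulrDr !mulr_sumr.
by congr (_ + _); apply: eq_bigr => i _;
  rewrite big_ord1 !mxE exprMn expr2 mulrA ss mul1r expr2.
Qed.

End CPToTraining.

Theorem theorem2 (R : realType) (d c n : nat)
    (hd : (0 < d)%N) (hc : (0 < c)%N) (hn : (0 < n)%N)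
    (X : 'M[R]_(n, d)) (Y : 'M[R]_(n, c)) (gamma : R) (hgamma : 0 <= gamma) :
  training_value X Y gamma = cpnn_value X Y gamma.
Proof.
apply/le_anti/andP; split; apply: le_ereal_inf_tmp.
  move=> _ [L /(cpnn_feasible_training Y gamma)[nu nuP nuL] <-].
  by apply: ereal_inf_lbound; exists nu.
by move=> _ [nu nuP <-]; exact: cpnn_value_le_training_objective.
Qed.
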